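(* The polynomial $\mathcal D_{n-2}^{(n)}$ belongs to the square-graph cone $\mathcal C_{n,2}$ for all $n\ge 2$, and the polynomial $\mathcal D_{n-3}^{(n)}$ belongs to the square-graph cone $\mathcal C_{n,6}$ for all $n\ge 3$.
   Context: Let $x_1,\dots,x_n$ be indeterminates, $P(t)=\prod_{i=1}^n(t-x_i)$, and for $0\le k\le n-2$ let $\mathcal D_k^{(n)}=\operatorname{disc}(P^{(k)})=(-1)^{m(m-1)/2}c^{-1}\operatorname{Res}(P^{(k)},P^{(k+1)})$, where $m=n-k$ and $c$ is the leading coefficient of $P^{(k)}$; it is homogeneous of degree $(n-k)(n-k-1)$ in $x_1,\dots,x_n$. For a loopless multigraph $G$ on the vertex set $\{1,\dots,n\}$ with chosen edge orientations, set $M_G=\prod_{(i,j)\in E(G)}(x_i-x_j)$ (edges counted with multiplicity) and $\widetilde G=\sum_{\sigma\in S_n}M_G(x_{\sigma(1)},\dots,x_{\sigma(n)})$. $G$ is a square graph if every edge has even multiplicity; its degree is the number of edges counted with multiplicity. The square-graph cone $\mathcal C_{n,d}$ is the set of all finite nonnegative real linear combinations of the polynomials $\widetilde G$ with $G$ a square graph of degree $d$ on $\{1,\dots,n\}$. *)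

(* Defs.v *)
From HB Require Import structures.
From mathcomp Require Import all_boot all_order all_fingroup all_algebra.
From mathcomp Require Import reals.
From mathcomp Require Import mpoly.

Set Implicit Arguments.
Unset Strict Implicit.
Unset Printing Implicit Defensive.

Import Order.TTheory GRing.Theory Num.Theory.
Local Open Scope ring_scope.

(* The sign is that of the classical convention for the resultant: the
   library's Sylvester matrix lists coefficients by increasing degree, which
   multiplies the classical resultant of p and q by (-1)^(deg p * deg q), and
   here deg p * deg p^`() = m (m - 1) is even (when p^`() has degree m - 1).
   The inverse is only meaningful when lead_coef p is a unit of A. *)
Definition disc (A : comUnitRingType) (p : {poly A}) : A :=
  let m := (size p).-1 in
  (-1) ^+ (m * (m - 1) %/ 2) * (lead_coef p)^-1 * resultant p p^`().

Definition genericP (R : realType) (n : nat) : {poly {mpoly R[n]}} :=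
  \prod_(i < n) ('X - ('X_i : {mpoly R[n]})%:P).

(* For k <= n - 2 the leading coefficient of the k-th derivative is the
   nonzero constant n ^_ k, hence a unit of {mpoly R[n]}. *)
Definition disc_deriv (R : realType) (n k : nat) : {mpoly R[n]} :=
  disc (genericP R n)^`(k).

(* arcs i j is the number of edges joining i and j that are oriented from i to
   j. One orientation is chosen for all the parallel edges joining two given
   vertices (otherwise the graph with edges (i, j) and (j, i) would be a square
   graph with monomial - (x_i - x_j)^2). *)
Record multigraph (n : nat) := Multigraph {
  arcs :> {ffun 'I_n * 'I_n -> nat};
  arcs_loopless : forall i, arcs (i, i) = 0%N;
  arcs_oriented : forall i j, arcs (i, j) = 0%N \/ arcs (j, i) = 0%N
}.

Definition edge_mult (n : nat) (G : multigraph n) (i j : 'I_n) : nat :=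
  (G (i, j) + G (j, i))%N.

Definition square_graph (n : nat) (G : multigraph n) : Prop :=
  forall i j, ~~ odd (edge_mult G i j).

Definition graph_degree (n : nat) (G : multigraph n) : nat :=
  (\sum_(e : 'I_n * 'I_n) G e)%N.

Definition graph_monomial (R : realType) (n : nat) (G : multigraph n) :
    {mpoly R[n]} :=
  \prod_(e : 'I_n * 'I_n) ('X_(e.1) - 'X_(e.2)) ^+ G e.

(* msym s p is p(x_{s 1}, ..., x_{s n}); no division by n!. *)
Definition sym_graph (R : realType) (n : nat) (G : multigraph n) :
    {mpoly R[n]} :=
  \sum_(s : 'S_n) msym s (graph_monomial R G).

Definition square_graph_cone (R : realType) (n d : nat) (p : {mpoly R[n]}) :
    Prop :=
  exists (N : nat) (a : 'I_N -> R) (G : 'I_N -> multigraph n),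
    (forall l, [/\ 0 <= a l, square_graph (G l) & graph_degree (G l) = d]) /\
    p = \sum_(l < N) a l *: sym_graph R (G l).

(* Main.v *)
Require Import Defs.
From HB Require Import structures.
From mathcomp Require Import all_boot all_order all_fingroup all_algebra.
From mathcomp Require Import reals.
From mathcomp Require Import mpoly.
From mathcomp Require Import ring.

Set Implicit Arguments.
Unset Strict Implicit.
Unset Printing Implicit Defensive.

Import Order.TTheory GRing.Theory Num.Theory.
Local Open Scope ring_scope.

(* Put d_ij = (x_i - x_j)^2 and let w_k be the sum of the d_ij over all i, j
   distinct from k.  The quadratic sum_k w_k (t - x_k)^2 agrees, up to a factor
   and a constant term, with the Hessian of P^(n-3); its discriminant is
   -2 sum_(k, l) w_k w_l d_kl, and the discriminant of a cubic is, up to a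
   factor, that of its Hessian.  This leads to the identity
     288 disc(P^(n-3)) = (n-1)! (n-2)! (n-3)!^2
        (3 sum_(k, l) w_k w_l d_kl + 4 n (n-2) sum_(i, j, k) d_ij d_ik d_jk),
   checked by writing both sides in the power sums of the x_i.  Similarly
   2 disc(P^(n-2)) = (n-1)! (n-2)! sum_(i, j) d_ij.  Both right-hand sides are
   symmetric and nonnegative combinations of products of d_ij, so averaging
   over the symmetric group puts them in the cone. *)

(** * Sylvester determinants of sizes 3 and 5 *)

Section Determinants.
Variable A : comNzRingType.

(* Indexing the entries by nat avoids transports between the type
   'M_((size q).-1 + (size p).-1) of a Sylvester matrix and 'M_3 or 'M_5. *)
Definition nat_det (n : nat) (f : nat -> nat -> A) : A :=
  \det (\matrix_(i < n, j < n) f i j).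

Lemma nat_det0 f : nat_det 0 f = 1.
Proof. exact: det_mx00. Qed.

Lemma nat_detS n f :
  nat_det n.+1 f = \sum_(i < n.+1)
    f i 0%N * ((-1) ^+ i * nat_det n (fun k j => f (bump i k) j.+1)).
Proof.
rewrite /nat_det (expand_det_col _ ord0); apply: eq_bigr => j _.
rewrite mxE /cofactor addn0; congr (_ * (_ * \det _)).
by apply/matrixP=> i k; rewrite !mxE.
Qed.

Lemma eq_nat_det n f g :
  (forall i j, (i < n)%N -> (j < n)%N -> f i j = g i j) -> nat_det n f = nat_det n g.
Proof.
by move=> fg; congr (\det _); apply/matrixP=> i j; rewrite !mxE fg.
Qed.

(** The factors [*+ (i <= j)] and [*+ (i - b <= j)] put zeros to the left of each shifted row, where
    truncated subtraction would otherwise produce a constant coefficient. *)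
Lemma resultant_nat_det (p q : {poly A}) (a b : nat) :
  size p = a.+1 -> size q = b.+1 ->
  resultant p q = nat_det (b + a) (fun i j =>
    if (i < b)%N then p`_(j - i) *+ (i <= j)
    else q`_(j - (i - b)) *+ (i - b <= j)).
Proof.
move=> sp sq; have [ea eb] : (size p).-1 = a /\ (size q).-1 = b.
  by rewrite sp sq.
rewrite /resultant -{a sp}ea -{b sq}eb; congr (\det _).
apply/matrixP=> i j; rewrite Sylvester_mxE mxE.
by case: (split_ordP i) => k -> //=; rewrite addKn.
Qed.

Definition mx_of_rows (s : seq (seq A)) (i j : nat) : A := nth 0 (nth [::] s i) j.

Lemma det_sylvester_quadratic (a b c : A) :
  nat_det 3 (mx_of_rows [:: [:: a; b; c]; [:: b; c *+ 2; 0]; [:: 0; b; c *+ 2]])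
  = - (c * (b ^+ 2 - 4 * c * a)).
Proof.
rewrite /mx_of_rows.
do 3 ! rewrite !nat_detS !(big_ord_recl, big_ord0) /= /bump /= ?(mul0r, add0r, addr0).
by rewrite nat_det0; ring.
Qed.

Lemma det_sylvester_cubic (a b c d : A) :
  nat_det 5 (mx_of_rows [:: [:: a; b; c; d; 0]; [:: 0; a; b; c; d];
    [:: b; c *+ 2; d *+ 3; 0; 0]; [:: 0; b; c *+ 2; d *+ 3; 0];
    [:: 0; 0; b; c *+ 2; d *+ 3]])
  = - (d * (b ^+ 2 * c ^+ 2 - 4 * d * b ^+ 3 - 4 * c ^+ 3 * a
            + 18 * d * c * b * a - 27 * d ^+ 2 * a ^+ 2)).
Proof.
rewrite /mx_of_rows.
do 5 ! rewrite !nat_detS !(big_ord_recl, big_ord0) /= /bump /= ?(mul0r, add0r, addr0).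
by rewrite nat_det0; ring.
Qed.

End Determinants.

(** * Discriminants of quadratics and cubics in their coefficients *)

Section Discriminants.
Variable A : comUnitRingType.
Implicit Types p : {poly A}.

(** Over a general ring differentiation may lower the degree by more than one; the second hypothesis
    keeps the leading term of the derivative alive. *)
Lemma size_deriv_lead p m : size p = m.+2 -> p`_m.+1 *+ m.+1 != 0 ->
  size p^`() = m.+1.
Proof.
move=> sp nz; apply/eqP; rewrite eqn_leq; apply/andP; split.
  by rewrite -ltnS -sp lt_size_deriv // -size_poly_gt0 sp.
by rewrite ltnNge; apply: contra nz => le_m; rewrite -coef_deriv nth_default.
Qed.

Lemma disc_quadratic p : size p = 3%N -> p`_2 \is a GRing.unit ->
  p`_2 *+ 2 != 0 ->
  disc p = p`_1 ^+ 2 - 4 * p`_2 * p`_0.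
Proof.
move=> sp up nz; have sq := size_deriv_lead sp nz.
have p3 : p`_3 = 0 by rewrite nth_default ?sp.
rewrite /disc (resultant_nat_det sp sq) lead_coefE sp.
(* The sign exponent is 2 * 1 / 2 = 1; this sign cancels the one of the determinant, and the inverse
   cancels its factor, the leading coefficient. *)
rewrite -[(_ %/ 2)%N]/1%N expr1.
rewrite (eq_nat_det (g := mx_of_rows [:: [:: p`_0; p`_1; p`_2];
  [:: p`_1; p`_2 *+ 2; 0]; [:: 0; p`_1; p`_2 *+ 2]])).
  by rewrite det_sylvester_quadratic mulN1r mulrNN mulKr.
by move=> [|[|[|i]]] [|[|[|j]]] //= _ _;
  rewrite ?subSS ?subn0 ?sub0n ?coef_deriv ?p3 ?mul0rn.
Qed.

Lemma disc_cubic p : size p = 4%N -> p`_3 \is a GRing.unit ->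
  p`_3 *+ 3 != 0 ->
  disc p = p`_1 ^+ 2 * p`_2 ^+ 2 - 4 * p`_3 * p`_1 ^+ 3
    - 4 * p`_2 ^+ 3 * p`_0 + 18 * p`_3 * p`_2 * p`_1 * p`_0
    - 27 * p`_3 ^+ 2 * p`_0 ^+ 2.
Proof.
move=> sp up nz; have sq := size_deriv_lead sp nz.
have p4 : p`_4 = 0 by rewrite nth_default ?sp.
have p5 : p`_5 = 0 by rewrite nth_default ?sp.
rewrite /disc (resultant_nat_det sp sq) lead_coefE sp.
(* The sign exponent is now 3 * 2 / 2 = 3. *)
rewrite -[(_ %/ 2)%N]/3%N -[_ ^+ 3]/(-1 * (-1 * -1)) mulrNN mulr1 mulr1.
rewrite (eq_nat_det (g := mx_of_rows [:: [:: p`_0; p`_1; p`_2; p`_3; 0];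
  [:: 0; p`_0; p`_1; p`_2; p`_3];
  [:: p`_1; p`_2 *+ 2; p`_3 *+ 3; 0; 0];
  [:: 0; p`_1; p`_2 *+ 2; p`_3 *+ 3; 0];
  [:: 0; 0; p`_1; p`_2 *+ 2; p`_3 *+ 3]])).
  by rewrite det_sylvester_cubic mulN1r mulrNN mulKr.
by move=> [|[|[|[|[|i]]]]] [|[|[|[|[|j]]]]] //= _ _;
  rewrite ?subSS ?subn0 ?sub0n ?coef_deriv ?p4 ?p5 ?mul0rn.
Qed.

End Discriminants.

(** * Vieta's formulas and Newton's identities *)

Section ElementarySymmetric.
Variable A : comNzRingType.
Implicit Types s : seq A.

Fixpoint elem_sym (k : nat) s : A :=
  match k, s with
  | 0, _ => 1
  | _.+1, [::] => 0
  | k'.+1, x :: s' => elem_sym k s' + x * elem_sym k' s'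
  end.

Lemma elem_sym0 s : elem_sym 0 s = 1.
Proof. by case: s. Qed.

Lemma elem_symS k x s : elem_sym k.+1 (x :: s) = elem_sym k.+1 s + x * elem_sym k s.
Proof. by []. Qed.

Lemma elem_sym_big k s : (size s < k)%N -> elem_sym k s = 0.
Proof.
elim: s k => [|x s IHs] [|k] //= lt_k.
by rewrite !IHs ?mulr0 ?addr0 // ltnW.
Qed.

(** Vieta, by induction on the roots: multiplying by X - x reproduces the recursion of [elem_sym].
    The cases m = 0 and k = 0 are separate because one of the two terms then vanishes. *)
Lemma coef_prod_XsubC_elem_sym s m k : size s = (m + k)%N ->
  (\prod_(x <- s) ('X - x%:P))`_m = (-1) ^+ k * elem_sym k s.
Proof.
elim: s m k => [|x s IHs] m k.
  by case: m k => [|m] [|k] // _; rewrite big_nil coef1 mulr1.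
move=> /= sz; rewrite big_cons mulrBl coefB coefXM coefCM.
case: m k sz => [|m] [|k] //= [sz].
- by rewrite (IHs 0%N k) // (elem_sym_big (k := k.+1)) ?sz // exprS; ring.
- rewrite (IHs m 0%N) // [X in x * X]nth_default.
    by rewrite mulr0 subr0; case: (s).
  by rewrite size_prod_XsubC sz addn0.
- by rewrite (IHs m k.+1) // (IHs m.+1 k) ?sz ?addnS // exprS; ring.
Qed.

(** The exponent 1 is kept so that the sum matches [psum] at 1. *)
Lemma elem_sym1E s : elem_sym 1 s = \sum_(x <- s) x ^+ 1.
Proof.
elim: s => [|x s IHs]; first by rewrite big_nil.
by rewrite big_cons -IHs elem_symS elem_sym0; ring.
Qed.

Lemma elem_sym2E s :
  2 * elem_sym 2 s = (\sum_(x <- s) x ^+ 1) ^+ 2 - \sum_(x <- s) x ^+ 2.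
Proof.
rewrite -elem_sym1E; elim: s => [|x s IHs]; first by rewrite big_nil /=; ring.
by rewrite big_cons !elem_symS elem_sym0 mulrDr IHs; ring.
Qed.

Lemma elem_sym3E s :
  6 * elem_sym 3 s = (\sum_(x <- s) x ^+ 1) ^+ 3
    - 3 * (\sum_(x <- s) x ^+ 1) * (\sum_(x <- s) x ^+ 2) + 2 * \sum_(x <- s) x ^+ 3.
Proof.
rewrite -elem_sym1E; elim: s => [|x s IHs]; first by rewrite !big_nil /=; ring.
rewrite !big_cons !elem_symS elem_sym0 mulrDr IHs.
have -> : 6 * (x * elem_sym 2 s) = 3 * x * (2 * elem_sym 2 s) by ring.
by rewrite elem_sym2E -elem_sym1E; ring.
Qed.

End ElementarySymmetric.

(** * Sums of products of squared differences as polynomials in power sums *)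

Section PowerSums.
Variables (A : comNzRingType) (n : nat) (x : 'I_n -> A).

Definition psum k := \sum_i x i ^+ k.

Definition sqd i j := (x i - x j) ^+ 2.

Local Notation p := psum.
Local Notation d := sqd.

(** The tool for evaluating nested sums from the inside out: each summand below has degree at most 4
    in the current variable. *)
Lemma sum_quartic (f : 'I_n -> A) (c0 c1 c2 c3 c4 : A) :
  (forall i, f i = c0 + c1 * x i + c2 * x i ^+ 2 + c3 * x i ^+ 3 + c4 * x i ^+ 4) ->
  \sum_i f i = c0 * n%:R + c1 * p 1 + c2 * p 2 + c3 * p 3 + c4 * p 4.
Proof.
move=> ef; rewrite (eq_bigr _ (fun i _ => ef i)) !big_split /= sumr_const card_ord.
rewrite mulr_natr /psum !mulr_sumr.
by congr (_ + _ + _ + _ + _); apply: eq_bigr => i _; rewrite expr1.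
Qed.

Lemma sum_sqd_row i : \sum_j d i j = p 2 - 2 * p 1 * x i + n%:R * x i ^+ 2.
Proof.
rewrite (sum_quartic (c0 := x i ^+ 2) (c1 := - (2 * x i)) (c2 := 1)
  (c3 := 0) (c4 := 0)); first by ring.
by move=> j; rewrite /sqd; ring.
Qed.

Lemma sum_sqd_all : \sum_i \sum_j d i j = 2 * (n%:R * p 2 - p 1 ^+ 2).
Proof.
rewrite (sum_quartic (c0 := p 2) (c1 := - (2 * p 1)) (c2 := n%:R)
  (c3 := 0) (c4 := 0)); first by ring.
by move=> i; rewrite sum_sqd_row; ring.
Qed.

(** The summand is a squared Vandermonde determinant, so by Cauchy-Binet the sum is 6 times the
    Hankel determinant of n, p 1, ..., p 4. The proof sums directly over k, then j, then i. *)
Lemma sum_sqd_triangle :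
  \sum_i \sum_j \sum_k d i j * (d i k * d j k) =
  6 * (n%:R * p 2 * p 4 - p 1 ^+ 2 * p 4 - n%:R * p 3 ^+ 2
       + 2 * p 1 * p 2 * p 3 - p 2 ^+ 3).
Proof.
have inner i j : \sum_k d i k * d j k =
    n%:R * x i ^+ 2 * x j ^+ 2 - 2 * x i * x j * (x i + x j) * p 1
    + (x i ^+ 2 + x j ^+ 2 + 4 * x i * x j) * p 2 - 2 * (x i + x j) * p 3 + p 4.
  rewrite (sum_quartic (c0 := x i ^+ 2 * x j ^+ 2)
    (c1 := - (2 * x i * x j * (x i + x j)))
    (c2 := x i ^+ 2 + x j ^+ 2 + 4 * x i * x j)
    (c3 := - (2 * (x i + x j))) (c4 := 1)); first by ring.
  by move=> k; rewrite /sqd; ring.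
have middle i : \sum_j \sum_k d i j * (d i k * d j k) =
    (2 * n%:R * p 2 - 2 * p 1 ^+ 2) * x i ^+ 4
    + (4 * p 1 * p 2 - 4 * n%:R * p 3) * x i ^+ 3
    + (2 * n%:R * p 4 + 4 * p 1 * p 3 - 6 * p 2 ^+ 2) * x i ^+ 2
    + (4 * p 2 * p 3 - 4 * p 1 * p 4) * x i + (2 * p 2 * p 4 - 2 * p 3 ^+ 2).
  (* The inner sum is q0 + q1 x_j + q2 x_j^2; the coefficients below come from multiplying it by
     d_ij. *)
  pose q2 := n%:R * x i ^+ 2 - 2 * p 1 * x i + p 2.
  pose q1 := - (2 * p 1 * x i ^+ 2) + 4 * p 2 * x i - 2 * p 3.
  pose q0 := p 2 * x i ^+ 2 - 2 * p 3 * x i + p 4.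
  rewrite (sum_quartic (c0 := x i ^+ 2 * q0)
    (c1 := x i ^+ 2 * q1 - 2 * x i * q0)
    (c2 := q0 - 2 * x i * q1 + x i ^+ 2 * q2)
    (c3 := q1 - 2 * x i * q2) (c4 := q2)); first by rewrite /q0 /q1 /q2; ring.
  by move=> j; rewrite -mulr_sumr inner /sqd /q0 /q1 /q2; ring.
rewrite (sum_quartic (c0 := 2 * p 2 * p 4 - 2 * p 3 ^+ 2)
  (c1 := 4 * p 2 * p 3 - 4 * p 1 * p 4)
  (c2 := 2 * n%:R * p 4 + 4 * p 1 * p 3 - 6 * p 2 ^+ 2)
  (c3 := 4 * p 1 * p 2 - 4 * n%:R * p 3)
  (c4 := 2 * n%:R * p 2 - 2 * p 1 ^+ 2)); first by ring.
by move=> i; rewrite middle; ring.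
Qed.

Definition avoiding_weight k : A := \sum_(i | i != k) \sum_(j | j != k) d i j.

(** Inclusion-exclusion: the full double sum minus row k and column k, with d_kk = 0. The result is
    quadratic in x_k, so multiplying by x_k^2 stays within the reach of [sum_quartic]. *)
Lemma avoiding_weightE k : avoiding_weight k =
  2 * (n%:R * p 2 - p 1 ^+ 2) - 2 * p 2 + 4 * p 1 * x k - 2 * n%:R * x k ^+ 2.
Proof.
have colE i : \sum_(j | j != k) d i j = \sum_j d i j - d i k.
  by rewrite [in RHS](bigD1 k) //= addrC addrK.
rewrite /avoiding_weight (eq_bigr _ (fun i _ => colE i)).
have -> (f : 'I_n -> A) : \sum_(i | i != k) f i = \sum_i f i - f k.
  by rewrite [in RHS](bigD1 k) //= addrC addrK.
have dC i : d i k = d k i by rewrite /sqd; ring.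
rewrite sumrB sum_sqd_all (eq_bigr _ (fun i _ => dC i)) !sum_sqd_row.
by rewrite /sqd; ring.
Qed.

(** A weighted variance identity; the right-hand side is -1/2 times the discriminant of the
    quadratic sum_k w_k (t - x_k)^2. *)
Lemma weighted_sqd (w : 'I_n -> A) :
  \sum_i \sum_j w i * w j * d i j =
  2 * ((\sum_i w i) * (\sum_i w i * x i ^+ 2) - (\sum_i w i * x i) ^+ 2).
Proof.
have row i : \sum_j w i * w j * d i j =
    (\sum_j w j * x j ^+ 2) * w i - 2 * (\sum_j w j * x j) * (w i * x i)
    + (\sum_j w j) * (w i * x i ^+ 2).
  rewrite (eq_bigr (fun j => w i * (w j * x j ^+ 2)
    - 2 * w i * x i * (w j * x j) + w i * x i ^+ 2 * w j)).
    by rewrite big_split sumrB /= -!mulr_sumr; ring.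
  by move=> j _; rewrite /sqd; ring.
rewrite (eq_bigr _ (fun i _ => row i)) big_split sumrB /= -!mulr_sumr.
by ring.
Qed.

Lemma sum_avoiding_sqd :
  \sum_i \sum_j avoiding_weight i * avoiding_weight j * d i j =
  2 * (let c := 2 * (n%:R * p 2 - p 1 ^+ 2) - 2 * p 2 in
    (c * n%:R + 4 * p 1 * p 1 - 2 * n%:R * p 2) *
    (c * p 2 + 4 * p 1 * p 3 - 2 * n%:R * p 4)
   - (c * p 1 + 4 * p 1 * p 2 - 2 * n%:R * p 3) ^+ 2).
Proof.
set c := 2 * (n%:R * p 2 - p 1 ^+ 2) - 2 * p 2.
rewrite weighted_sqd; congr (2 * (_ * _ - _ ^+ 2)).
- rewrite (sum_quartic (c0 := c) (c1 := 4 * p 1) (c2 := - (2 * n%:R))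
    (c3 := 0) (c4 := 0)); first by ring.
  by move=> i; rewrite avoiding_weightE -/c; ring.
- rewrite (sum_quartic (c0 := 0) (c1 := 0) (c2 := c) (c3 := 4 * p 1)
    (c4 := - (2 * n%:R))); first by ring.
  by move=> i; rewrite avoiding_weightE -/c; ring.
- rewrite (sum_quartic (c0 := 0) (c1 := c) (c2 := 4 * p 1)
    (c3 := - (2 * n%:R)) (c4 := 0)); first by ring.
  by move=> i; rewrite avoiding_weightE -/c; ring.
Qed.

Definition square_sum6 : A :=
  3 * (\sum_i \sum_j avoiding_weight i * avoiding_weight j * d i j)
  + (4 * n * (n - 2))%:R * \sum_i \sum_j \sum_k d i j * (d i k * d j k).

End PowerSums.

(** Here a0, ..., a3 stand for the coefficients of P^(m) and M for m!. The factors 2 and 6 clear the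
    denominators of Newton's identities. *)
Lemma cubic_square_sum6 (A : comNzRingType) (m : nat) (x : 'I_m.+3 -> A)
    (M a0 a1 a2 a3 : A) :
  let p := psum x in
  6 * a3 = (m.+3)%:R * (m.+2)%:R * (m.+1)%:R * M ->
  2 * a2 = - ((m.+2)%:R * (m.+1)%:R * M * p 1) ->
  2 * a1 = (m.+1)%:R * M * (p 1 ^+ 2 - p 2) ->
  6 * a0 = - (M * (p 1 ^+ 3 - 3 * p 1 * p 2 + 2 * p 3)) ->
  288 * (a1 ^+ 2 * a2 ^+ 2 - 4 * a3 * a1 ^+ 3 - 4 * a2 ^+ 3 * a0
    + 18 * a3 * a2 * a1 * a0 - 27 * a3 ^+ 2 * a0 ^+ 2) =
  M ^+ 4 * (m.+1)%:R ^+ 2 * (m.+2)%:R * square_sum6 x.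
Proof.
move=> p e3 e2 e1 e0.
(* The factor 288 lets every term be written with integer coefficients in 6 a3, 2 a2, 2 a1, 6 a0. *)
transitivity (18 * (2 * a1) ^+ 2 * (2 * a2) ^+ 2 - 24 * (6 * a3) * (2 * a1) ^+ 3
  - 24 * (2 * a2) ^+ 3 * (6 * a0) + 36 * (6 * a3) * (2 * a2) * (2 * a1) * (6 * a0)
  - 6 * (6 * a3) ^+ 2 * (6 * a0) ^+ 2); first by ring.
rewrite e3 e2 e1 e0 /square_sum6 sum_avoiding_sqd sum_sqd_triangle -/p.
rewrite -[(m.+3 - 2)%N]/(m.+1) !natrM.
(* What remains is a polynomial identity in M, m and four free power sums. *)
move: (p 1) (p 2) (p 3) (p 4) => p1 p2 p3 p4.
by cbv zeta; ring.
Qed.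

(** * Closure properties of the cone and graphs of products of squares *)

Section Cone.
Variables (R : realType) (n : nat).
Implicit Types (p q : {mpoly R[n]}) (es : seq ('I_n * 'I_n)).

Lemma square_graph_cone0 d : square_graph_cone d (0 : {mpoly R[n]}).
Proof.
exists 0%N, (fun=> 0), (fun i : 'I_0 => False_rect _ (notF (ltn_ord i))).
by split=> [[]|]; rewrite ?big_ord0.
Qed.

Lemma square_graph_coneD d p q :
  square_graph_cone d p -> square_graph_cone d q -> square_graph_cone d (p + q).
Proof.
move=> [N1 [a1 [G1 [H1 ->]]]] [N2 [a2 [G2 [H2 ->]]]].
exists (N1 + N2)%N.
exists (fun l => match split l with inl i => a1 i | inr i => a2 i end).
exists (fun l => match split l with inl i => G1 i | inr i => G2 i end).
split=> [l|]; first by case: split.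
rewrite big_split_ord; congr (_ + _); apply: eq_bigr => i _.
- by case: split_ordP => j /eqP; rewrite ?eq_lrshift // eq_lshift => /eqP ->.
- by case: split_ordP => j /eqP; rewrite ?eq_rlshift // eq_rshift => /eqP ->.
Qed.

Lemma square_graph_coneZ d c p :
  0 <= c -> square_graph_cone d p -> square_graph_cone d (c *: p).
Proof.
move=> c0 [N [a [G [H ->]]]]; exists N, (fun l => c * a l), G; split=> [l|].
  by have [a0 ? ?] := H l; rewrite mulr_ge0.
by rewrite scaler_sumr; apply: eq_bigr => l _; rewrite scalerA.
Qed.

(* Parallel edges of a multigraph must have the same orientation. *)
Definition sort_edge (e : 'I_n * 'I_n) := if (e.1 < e.2)%N then e else (e.2, e.1).

Lemma sort_edge_lt e : e.1 != e.2 -> ((sort_edge e).1 < (sort_edge e).2)%N.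
Proof.
by rewrite /sort_edge -val_eqE /= neq_ltn; case: ifP => //= ->.
Qed.

(** Each entry of the list contributes one double edge, and repeated entries accumulate, so any
    product of the d_ij can be encoded. *)
Definition doubled_arcs es : {ffun 'I_n * 'I_n -> nat} :=
  [ffun e => \sum_(e' <- es) (if e == sort_edge e' then 2%N else 0%N)].

Lemma doubled_arcs_lt es i j : all (fun e => e.1 != e.2) es ->
  doubled_arcs es (i, j) != 0%N -> (i < j)%N.
Proof.
rewrite ffunE => /allP les; apply: contraR => ltij.
rewrite big_seq big1 // => e /les /sort_edge_lt.
by case: eqP => // <-; rewrite (negPf ltij).
Qed.

Lemma doubled_arcs_loopless es : all (fun e => e.1 != e.2) es ->
  forall i, doubled_arcs es (i, i) = 0%N.
Proof.
by move=> les i; apply/eqP; apply: contraFT (ltnn i) => /(doubled_arcs_lt les).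
Qed.

Lemma doubled_arcs_oriented es : all (fun e => e.1 != e.2) es ->
  forall i j, doubled_arcs es (i, j) = 0%N \/ doubled_arcs es (j, i) = 0%N.
Proof.
move=> les i j; have [|/(doubled_arcs_lt les) ltij] :=
  eqVneq (doubled_arcs es (i, j)) 0%N; first by left.
right; apply: contraTeq ltij => /(doubled_arcs_lt les).
by rewrite -leqNgt => /ltnW.
Qed.

Definition doubled_graph es (les : all (fun e => e.1 != e.2) es) : multigraph n :=
  Multigraph (doubled_arcs_loopless les) (doubled_arcs_oriented les).

Lemma doubled_graph_square es les : square_graph (@doubled_graph es les).
Proof.
move=> i j; rewrite /edge_mult /= !ffunE -big_split.
elim/big_ind: _ => //= [x y|e _]; first by rewrite oddD => /negPf-> /negPf->.
by do 2 case: ifP.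
Qed.

Lemma doubled_graph_degree es les :
  graph_degree (@doubled_graph es les) = (2 * size es)%N.
Proof.
rewrite /graph_degree /=; under eq_bigr do rewrite ffunE.
rewrite exchange_big /= (eq_bigr (fun=> 2%N)).
  by rewrite big_const_seq count_predT iter_addn_0.
by move=> e _; rewrite -big_mkcond /= big_pred1_eq.
Qed.

Lemma doubled_graph_monomial es les :
  graph_monomial R (@doubled_graph es les) =
  \prod_(e <- es) sqd (fun i => 'X_i) e.1 e.2.
Proof.
rewrite /graph_monomial /=; under eq_bigr do rewrite ffunE -prodrXr.
rewrite exchange_big /=; apply: eq_bigr => e _.
rewrite (bigD1 (sort_edge e)) //= eqxx big1 ?mulr1; last first.
  by move=> e' /negPf ->.
(* Reversing an edge changes the sign of its difference, which the square absorbs. *)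
by rewrite /sort_edge /sqd; case: ifP => //= _; rewrite -opprB sqrrN.
Qed.

Definition symmetrization p := \sum_(s : 'S_n) msym s p.

(** A list with a loop gives the zero product, which is in the cone; the sums of the overview can
    therefore run over all indices, coinciding ones included. *)
Lemma symmetrization_prod_sqd es d : d = (2 * size es)%N ->
  square_graph_cone d (symmetrization (\prod_(e <- es) sqd (fun i => 'X_i) e.1 e.2)).
Proof.
move=> ->; case: (boolP (all (fun e => e.1 != e.2) es)) => [les|].
  exists 1%N, (fun=> 1), (fun=> doubled_graph les); split=> [l|].
    by rewrite ler01 doubled_graph_degree; split=> //; apply: doubled_graph_square.
  by rewrite big_ord1 scale1r /sym_graph doubled_graph_monomial.
case/allPn => e ees; rewrite negbK => /eqP le.
suff -> : \prod_(e <- es) sqd (fun i => 'X_i : {mpoly R[n]}) e.1 e.2 = 0.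
  rewrite /symmetrization big1; first exact: square_graph_cone0.
  by move=> s _; rewrite msym0.
apply/eqP; rewrite prodf_seq_eq0; apply/hasP; exists e => //=.
by rewrite /sqd le subrr expr0n.
Qed.

(** The symmetrization of a symmetric p is n! p, and the cone is stable under division by n!. *)
Lemma symmetric_square_graph_cone d p : p \is symmetric ->
  square_graph_cone d (symmetrization p) -> square_graph_cone d p.
Proof.
move=> /issymP sp; rewrite /symmetrization (eq_bigr (fun=> p)); last by move=> s _.
rewrite sumr_const -scaler_nat => /(square_graph_coneZ (c := #|'S_n|%:R^-1)).
rewrite scalerA mulVf ?scale1r; first by apply; rewrite invr_ge0 ler0n.
by rewrite pnatr_eq0 -lt0n; apply/card_gt0P; exists 1%g.
Qed.

(** Single products of the d_ij need not be symmetric. This property, stable under sums and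
    nonnegative scaling, is checked term by term; symmetry is required only of the total. *)
Definition symmetrizes_into_cone d p := square_graph_cone d (symmetrization p).

Lemma symmetrizes_into_coneZ d c p : 0 <= c ->
  symmetrizes_into_cone d p -> symmetrizes_into_cone d (c *: p).
Proof.
rewrite /symmetrizes_into_cone => c0 /(square_graph_coneZ c0).
by rewrite /symmetrization scaler_sumr; under eq_bigr do rewrite -linearZ.
Qed.

Lemma symmetrizes_into_coneD d p q :
  symmetrizes_into_cone d p -> symmetrizes_into_cone d q ->
  symmetrizes_into_cone d (p + q).
Proof.
rewrite /symmetrizes_into_cone => cp /(square_graph_coneD cp).
by rewrite /symmetrization -big_split /=; under eq_bigr do rewrite -raddfD.
Qed.

Lemma symmetrizes_into_cone_sum d (I : finType) (P : pred I) (F : I -> {mpoly R[n]}) :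
  (forall i, P i -> symmetrizes_into_cone d (F i)) ->
  symmetrizes_into_cone d (\sum_(i | P i) F i).
Proof.
move=> FC; elim/big_ind: _ => //; last exact: symmetrizes_into_coneD.
rewrite /symmetrizes_into_cone /symmetrization big1; first exact: square_graph_cone0.
by move=> s _; rewrite msym0.
Qed.

End Cone.

(** * The derivatives of the generic polynomial *)

Section Generic.
Variable R : realType.

Local Notation X := (fun i => 'X_i : {mpoly R[_]}).

Lemma psum_sym n k : psum X k \is @symmetric n R.
Proof.
apply/issymP => s; rewrite raddf_sum [RHS](reindex_inj (@perm_inj _ s)) /=.
by apply: eq_bigr => i _; rewrite rmorphXn /= /msym mmapX mmap1U.
Qed.

(* Dispatching on the head symbol matters: trying [psum_sym] or [rpred_nat]
   blindly makes unification unfold the polynomials. *)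
Ltac sym_poly := repeat lazymatch goal with
  | |- is_true (psum _ _ \in _) => exact: psum_sym
  | |- is_true (_%:R \in _) => exact: rpred_nat
  | |- is_true (_ ^+ _ \in _) => apply: rpredX
  | |- is_true (_ - _ \in _) => apply: rpredB
  | |- is_true (_ + _ \in _) => apply: rpredD
  | |- is_true (_ * _ \in _) => apply: rpredM
  end.

(** Symmetry is read off the expression in power sums, with no reindexing of the sums. *)
Lemma sum_sqd_sym n : \sum_i \sum_j sqd X i j \is @symmetric n R.
Proof. by rewrite sum_sqd_all; sym_poly. Qed.

Lemma square_sum6_sym n : square_sum6 X \is @symmetric n R.
Proof.
rewrite /square_sum6 sum_avoiding_sqd sum_sqd_triangle.
by cbv zeta; sym_poly.
Qed.

Lemma sum_sqd_cone n : symmetrizes_into_cone 2 (\sum_i \sum_j sqd X i j : {mpoly R[n]}).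
Proof.
apply: symmetrizes_into_cone_sum => i _; apply: symmetrizes_into_cone_sum => j _.
by have := symmetrization_prod_sqd R (es := [:: (i, j)]) erefl; rewrite big_seq1.
Qed.

Lemma square_sum6_cone n : symmetrizes_into_cone 6 (square_sum6 X : {mpoly R[n]}).
Proof.
have cube3 (e1 e2 e3 : 'I_n * 'I_n) : symmetrizes_into_cone 6
    (sqd X e1.1 e1.2 * (sqd X e2.1 e2.2 * sqd X e3.1 e3.2)).
  by have := symmetrization_prod_sqd R (es := [:: e1; e2; e3]) erefl;
    rewrite !big_cons big_nil mulr1.
rewrite /square_sum6 !mulr_natl -!scaler_nat.
apply: symmetrizes_into_coneD; apply: symmetrizes_into_coneZ => //;
  do 2!apply: symmetrizes_into_cone_sum => ? _.
  (* Both weights are expanded, turning w_i w_j d_ij into a sum of products of three squared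
     differences. *)
  rewrite /avoiding_weight -mulrA mulr_suml.
  apply: symmetrizes_into_cone_sum => ? _; rewrite mulr_suml.
  apply: symmetrizes_into_cone_sum => ? _; rewrite mulr_suml mulr_sumr.
  apply: symmetrizes_into_cone_sum => ? _; rewrite mulr_suml mulr_sumr.
  apply: symmetrizes_into_cone_sum => ? _.
  exact: (cube3 (_, _) (_, _) (_, _)).
apply: symmetrizes_into_cone_sum => ? _.
exact: (cube3 (_, _) (_, _) (_, _)).
Qed.

Definition vars n : seq {mpoly R[n]} := [seq 'X_i | i <- enum 'I_n].

Lemma sum_vars n k : \sum_(x <- vars n) x ^+ k = psum X k.
Proof. by rewrite big_map big_enum. Qed.

Lemma genericPE n : genericP R n = \prod_(x <- vars n) ('X - x%:P).
Proof. by rewrite big_map big_enum. Qed.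

Lemma size_vars n : size (vars n) = n.
Proof. by rewrite size_map size_enum_ord. Qed.

(** The equation on k is a hypothesis so that the number of variables keeps the form m + 2 or m + 3
    when i and j vary. *)
Lemma coef_genericP_derivn m k i j : k = (i + j)%N ->
  (genericP R (m + k))^`(m)`_i
  = ((m + i) ^_ m)%:R * ((-1) ^+ j * elem_sym j (vars (m + k))).
Proof.
move=> ->; rewrite coef_derivn genericPE (coef_prod_XsubC_elem_sym (k := j)).
  by rewrite mulr_natl.
by rewrite size_vars addnA.
Qed.

Lemma natr_mpoly_unit n k : (0 < k)%N -> (k%:R : {mpoly R[n]}) \is a GRing.unit.
Proof.
by move=> k0; rewrite -(rmorph_nat (@mpolyC n R)) rmorph_unit // unitfE pnatr_eq0 -lt0n.
Qed.

Lemma natr_mpoly_neq0 n k : (0 < k)%N -> (k%:R : {mpoly R[n]}) != 0.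
Proof. by move/(@natr_mpoly_unit n); apply: contraTneq => ->; rewrite unitr0. Qed.

Lemma lead_genericP_derivn m k :
  (genericP R (m + k))^`(m)`_k = ((m + k) ^_ m)%:R.
Proof.
by rewrite (coef_genericP_derivn _ (esym (addn0 k))) elem_sym0 !mulr1.
Qed.

Lemma lead_genericP_derivn_unit m k :
  (genericP R (m + k))^`(m)`_k \is a GRing.unit.
Proof. by rewrite lead_genericP_derivn natr_mpoly_unit // ffact_gt0 leq_addr. Qed.

Lemma size_genericP_derivn m k : size (genericP R (m + k))^`(m) = k.+1.
Proof.
apply/eqP; rewrite eqn_leq; apply/andP; split.
  apply/leq_sizeP => j ltkj; rewrite coef_derivn genericPE nth_default ?mul0rn //.
  by rewrite size_prod_XsubC size_vars -addnS leq_add2l.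
rewrite ltnNge; apply: contraTN (lead_genericP_derivn_unit m k) => le_k.
by rewrite nth_default // unitr0.
Qed.

Lemma lead_genericP_derivn_mulrn m k c : (0 < c)%N ->
  (genericP R (m + k))^`(m)`_k *+ c != 0.
Proof.
move=> c0; rewrite -mulr_natr mulf_neq0 ?natr_mpoly_neq0 //.
by rewrite lead_genericP_derivn natr_mpoly_neq0 // ffact_gt0 leq_addr.
Qed.

Lemma ffact_addr m i : ((m + i) ^_ m * i`! = (m + i)`!)%N.
Proof. by rewrite -{2}(addKn m i) ffact_fact // leq_addr. Qed.

Lemma ffact_add2_natr (A : comNzRingType) m :
  2 * ((m + 2) ^_ m)%:R = m.+2%:R * m.+1%:R * m`!%:R :> A.
Proof. by rewrite -!natrM mulnC (ffact_addr m 2) addn2 !factS mulnA. Qed.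

Lemma disc_deriv_quadratic m :
  2 * disc_deriv R (m + 2) m =
  (m.+1 * m`! ^ 2)%:R * \sum_i \sum_j sqd X i j.
Proof.
rewrite /disc_deriv disc_quadratic ?size_genericP_derivn //;
  [|exact: lead_genericP_derivn_unit|exact: lead_genericP_derivn_mulrn].
rewrite sum_sqd_all; set q := _^`(m).
have e2 : 2 * q`_2 = m.+2%:R * m.+1%:R * m`!%:R.
  by rewrite lead_genericP_derivn ffact_add2_natr.
have e1 : q`_1 = - (m.+1%:R * m`!%:R * psum X 1).
  rewrite (coef_genericP_derivn m (erefl : 2 = 1 + 1)%N) elem_sym1E sum_vars.
  by have := ffact_addr m 1; rewrite muln1 addn1 => ->; rewrite factS natrM; ring.
have e0 : 2 * q`_0 = m`!%:R * (psum X 1 ^+ 2 - psum X 2).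
  rewrite (coef_genericP_derivn m (erefl : 2 = 0 + 2)%N).
  rewrite -!sum_vars -elem_sym2E.
  by have := ffact_addr m 0; rewrite muln1 addn0 => ->; ring.
(* Groups the discriminant into the multiples computed in [e2] and [e0]. *)
transitivity (2 * q`_1 ^+ 2 - 2 * (2 * q`_2) * (2 * q`_0)); first by ring.
by rewrite e2 e1 e0 natrM natrX addn2; ring.
Qed.

Lemma disc_deriv_cubic m :
  288 * disc_deriv R (m + 3) m =
  (m`! ^ 4 * m.+1 ^ 2 * m.+2)%:R * square_sum6 X.
Proof.
rewrite /disc_deriv disc_cubic ?size_genericP_derivn //;
  [|exact: lead_genericP_derivn_unit|exact: lead_genericP_derivn_mulrn].
rewrite !(natrX, natrM); set q := _^`(m).
have e3 : 6 * q`_3 = m.+3%:R * m.+2%:R * m.+1%:R * m`!%:R.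
  by rewrite lead_genericP_derivn -!natrM (mulnC 6) (ffact_addr m 3) addn3 !factS !mulnA.
have e2 : 2 * q`_2 = - (m.+2%:R * m.+1%:R * m`!%:R * psum X 1).
  rewrite (coef_genericP_derivn m (erefl : 3 = 2 + 1)%N) elem_sym1E sum_vars.
  by rewrite [LHS]mulrA ffact_add2_natr; ring.
have e1 : 2 * q`_1 = m.+1%:R * m`!%:R * (psum X 1 ^+ 2 - psum X 2).
  rewrite (coef_genericP_derivn m (erefl : 3 = 1 + 2)%N) -!sum_vars -elem_sym2E.
  by have := ffact_addr m 1; rewrite muln1 addn1 => ->; rewrite factS natrM; ring.
have e0 : 6 * q`_0 =
    - (m`!%:R * (psum X 1 ^+ 3 - 3 * psum X 1 * psum X 2 + 2 * psum X 3)).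
  rewrite (coef_genericP_derivn m (erefl : 3 = 0 + 3)%N) -!sum_vars -elem_sym3E.
  by have := ffact_addr m 0; rewrite muln1 addn0 => ->; ring.
(* The number of variables occurs in the types of [q] and [X]; once both are generalized, m + 3 can
   be rewritten to [m.+3]. *)
move: q X e3 e2 e1 e0; rewrite addn3 => q x.
exact: cubic_square_sum6.
Qed.

Lemma square_graph_cone_natr n d (c k : nat) (p q : {mpoly R[n]}) : (0 < c)%N ->
  c%:R * p = k%:R * q -> q \is symmetric -> symmetrizes_into_cone d q ->
  square_graph_cone d p.
Proof.
move=> c0 epq sq cq.
have -> : p = (c%:R^-1 * k%:R) *: q.
  rewrite -scalerA (scaler_nat k) -[q *+ k]mulr_natl -epq mulr_natl.
  rewrite -(scaler_nat c) scalerA mulVf ?scale1r //.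
  by rewrite pnatr_eq0 -lt0n.
apply/square_graph_coneZ/symmetric_square_graph_cone => //.
by rewrite mulr_ge0 ?invr_ge0 ?ler0n.
Qed.

End Generic.

Theorem corollary26 (R : realType) :
  (forall n : nat, (2 <= n)%N ->
     square_graph_cone 2 (disc_deriv R n (n - 2))) /\
  (forall n : nat, (3 <= n)%N ->
     square_graph_cone 6 (disc_deriv R n (n - 3))).
Proof.
split=> n /subnK.
- move: (n - 2)%N => m <-.
  exact: square_graph_cone_natr (disc_deriv_quadratic _ _)
    (sum_sqd_sym _ _) (sum_sqd_cone _ _).
- move: (n - 3)%N => m <-.
  exact: square_graph_cone_natr (disc_deriv_cubic _ _)
    (square_sum6_sym _ _) (square_sum6_cone _ _).
Qed.
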